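(* Let $n\ge 1$ and consider the pure summing register $\mathrm{PSR}_n$, i.e. the $n$-stage feedback shift register with feedback function $f_P(x_1,x_2,\dots,x_n)=x_1\oplus x_2\oplus\cdots\oplus x_n$. For a positive integer $d$ let $M(d)$ denote the number of cycles of length $d$ of $\mathrm{PSR}_n$. (1) If $n$ is even and $d\mid (n+1)$, or if $n$ is odd, $d\mid (n+1)$ and $(n+1)/d$ is odd, then $$M(d)=\frac{1}{2d}\sum_{d'\mid d}\mu(d')\,2^{d/d'}+\frac{1}{2d}\sum_{\substack{d'\mid d\\ d'\text{ even}}}\mu(d')\,2^{d/d'}.$$ (2) If $n$ is odd, $d\mid (n+1)$ and $(n+1)/d$ is even, then $$M(d)=\frac{1}{d}\sum_{d'\mid d}\mu(d')\,2^{d/d'}.$$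
   Context: $F_2$ is the field with two elements, $\oplus$ is addition modulo 2, and $\mu$ is the Möbius function. The $n$-stage feedback shift register (FSR) with feedback function $f:F_2^n\to F_2$ has state set $F_2^n$ and next-state operator $\rho:F_2^n\to F_2^n$, $\rho(a_1,\dots,a_n)=(a_2,\dots,a_n,f(a_1,\dots,a_n))$. A cycle of length $l$ is a cyclic sequence of $l$ distinct states $(S_i,S_{i+1},\dots,S_{i+l-1})$ with $S_{i+j+1}=\rho S_{i+j}$ for $0\le j\le l-2$ and $S_i=\rho S_{i+l-1}$ (cycles are considered up to cyclic rotation, i.e. they are the orbits of $\rho$ when $\rho$ is bijective). Sums over $d'\mid d$ run over the positive divisors of $d$; an empty sum is $0$. *)

(* Defs.v *)
From mathcomp Require Import all_boot all_order all_algebra.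

Set Implicit Arguments.
Unset Strict Implicit.
Unset Printing Implicit Defensive.

Import GRing.Theory.

Definition squarefree (m : nat) : bool :=
  (0 < m) && all (fun p => ~~ (p ^ 2 %| m)) (primes m).

Definition moebius (m : nat) : int :=
  if squarefree m then ((-1) ^+ size (primes m))%R else 0%R.

(* The i-th entry of the next state is the (i+1)-st entry of a; for the last
   index i = n - 1 the lookup is out of range and nth returns its default
   value, the feedback bit f a. *)
Definition next_state (n : nat) (f : n.-tuple 'F_2 -> 'F_2) (a : n.-tuple 'F_2) :
    n.-tuple 'F_2 :=
  [tuple nth (f a) a i.+1 | i < n].

Section Cycles.

Variables (T : finType) (rho : T -> T) (l : nat).

Definition is_cycle (c : l.-tuple T) : bool := fcycle rho c && uniq c.

Definition rotation_class (c : l.-tuple T) : {set l.-tuple T} :=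
  [set [tuple of rot (i : 'I_l) c] | i : 'I_l].

(* Cycles are counted up to cyclic rotation; only meaningful for l > 0. *)
Definition num_cycles : nat :=
  #|[set rotation_class c | c : l.-tuple T & is_cycle c]|.

End Cycles.

Definition psr_feedback (n : nat) (x : n.-tuple 'F_2) : 'F_2 :=
  (\sum_(i < n) tnth x i)%R.

Definition psr_num_cycles (n d : nat) : nat :=
  num_cycles (next_state (@psr_feedback n)) d.

(* Main.v *)
Require Import Defs.
From mathcomp Require Import all_boot all_order all_algebra.

Set Implicit Arguments.
Unset Strict Implicit.
Unset Printing Implicit Defensive.

Import GRing.Theory Num.Theory.

(** Appending the feedback bit to a state of PSR_n gives a word of length
    n + 1 whose letters sum to 0, since the feedback bit is itself the sum of
    the others and the characteristic is 2. Every zero-sum word of length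
    n + 1 arises in this way, from exactly one state, and one step of the
    register rotates the word by one place. Words are handled here through
    their (n + 1)-periodic extension to nat, the output sequence
    [psr_output x] of the state, on which a step is a shift of the index
    ([psr_output_next], [psr_output_onto]).

    In particular the next-state map has order dividing n + 1, so it is
    bijective, and the states fixed by its e-th iterate, for e dividing n + 1,
    are the words of period e. Such a word repeats a block of length e exactly
    (n + 1) / e times, and the zero-sum condition becomes (n + 1) / e times the
    sum of the block is 0. It constrains the block only when (n + 1) / e is
    odd, hence there are 2 ^ (e - 1) fixed states when (n + 1) / e is odd and
    2 ^ e when it is even ([card_psr_iter_fixedE]).

    For any bijection of a finite type, the fixed points of the e-th iterate
    are the points whose orbit length divides e ([card_iter_fixed]), and the
    points with orbit length d number d * M(d) ([num_cyclesE]). Moebius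
    inversion ([moebius_inversion]) then yields d * M(d) as the sum over d' | d
    of mu(d') times the number of points fixed by the (d / d')-th iterate. As
    (n + 1) / (d / d') is ((n + 1) / d) * d', the count for d' is halved exactly
    when (n + 1) / d and d' are both odd ([psr_num_cycles_moebius]). If
    (n + 1) / d is even nothing is halved; if it is odd, the terms
    with d' odd are halved and those with d' even are kept, which amounts to
    half of the whole sum plus half of its part over even d'. *)

(** * Rotation classes *)

Section RotationClass.
Variable T : finType.

(** Rotating by more than the size of the sequence is the identity, so the
    composite of two rotations need not be the rotation by the sum. *)
Lemma rot_rot_ex (s : seq T) i j : exists k, rot i (rot j s) = rot k s.
Proof.
case: (leqP (size s) j) => [/rot_oversize->|/ltnW js]; first by exists i.
case: (leqP (size s) i) => [si|/ltnW si]; last by eexists; apply: rot_add_mod.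
by exists j; rewrite rot_oversize ?size_rot.
Qed.

Variables (d : nat) (d_gt0 : 0 < d).
Implicit Types s t : d.-tuple T.

(** The bound [i < d] built into [rotation_class] is dropped, which frees the
    later arguments from reducing amounts of rotation modulo [d]. *)
Lemma rotation_classP s t :
  reflect (exists i, t = rot i s :> seq T) (t \in rotation_class s).
Proof.
apply: (iffP imsetP) => [[i _ ->]|[i t_rot]]; first by exists i.
case: (ltnP i d) => [i_lt|d_le].
  by exists (Ordinal i_lt) => //; apply: val_inj.
exists (Ordinal d_gt0) => //.
by apply: val_inj; rewrite /= t_rot rot0 rot_oversize ?size_tuple.
Qed.

Lemma rotation_class_refl s : s \in rotation_class s.
Proof. by apply/rotation_classP; exists 0; rewrite rot0. Qed.

Lemma eq_rotation_class s t :
  (rotation_class t == rotation_class s) = (t \in rotation_class s).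
Proof.
apply/eqP/idP => [<-|]; first exact: rotation_class_refl.
move=> /rotation_classP[i t_rot].
have s_rot : s = rot (d - i) t :> seq T.
  by rewrite t_rot -{1}(rotK i s) /rotr size_rot size_tuple.
apply/setP => u; apply/rotation_classP/rotation_classP => -[j ->].
  by rewrite t_rot; apply: rot_rot_ex.
by rewrite s_rot; apply: rot_rot_ex.
Qed.
End RotationClass.

(** * Counting the cycles of a bijection *)

Section CycleCount.
Variables (T : finType) (rho : T -> T).
Hypothesis rho_inj : injective rho.

Lemma iter_fixed_order e x : (iter e rho x == x) = (order rho x %| e).
Proof.
have iter_mul q : iter (q * order rho x) rho x = x.
  by elim: q => // q IHq; rewrite mulSn iterD IHq iter_order.
rewrite {1}(divn_eq e (order rho x)) addnC iterD iter_mul /dvdn.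
apply/eqP/eqP => [fix_r|->] //.
have r_lt := ltn_pmod e (order_gt0 rho x).
by rewrite -(findex_iter r_lt) fix_r findex0.
Qed.

Lemma card_iter_fixed e : 0 < e ->
  #|[set x | iter e rho x == x]| =
    \sum_(k <- divisors e) #|[set x | order rho x == k]|.
Proof.
move=> e_gt0; rewrite -sum1_card big_mkcond /=.
under [RHS]eq_bigr do rewrite -sum1_card big_mkcond /=.
rewrite exchange_big; apply: eq_bigr => x _ /=.
rewrite inE iter_fixed_order dvdn_divisors //.
case: ifP => [o_in|/negbT oNin].
  rewrite (bigD1_seq _ o_in (divisors_uniq e)) /= big1 => [|k /negbTE kNo].
    by rewrite inE eqxx.
  by rewrite inE eq_sym kNo.
rewrite big_seq big1 // => k k_in; rewrite inE; case: eqP => // ok.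
by rewrite ok k_in in oNin.
Qed.

(** A point of orbit length [d] determines a cycle, namely its orbit listed from
    that point on, and two such points give the same rotation class exactly when
    they lie on the same orbit. The map from points to classes is therefore
    onto with all fibres of size [d]. *)
Lemma num_cyclesE d : 0 < d ->
  num_cycles rho d * d = #|[set x | order rho x == d]|.
Proof.
move=> d_gt0; set X := [set x | _].
pose c x : d.-tuple T := [tuple iter i rho x | i < d].
have cE x : order rho x = d -> c x = orbit rho x :> seq T.
  move=> ox; apply: (@eq_from_nth _ x); rewrite size_tuple ?size_orbit //.
  move=> i i_lt; rewrite -[i]/(nat_of_ord (Ordinal i_lt)) -tnth_nth.
  by rewrite tnth_mktuple nth_traject ?ox.
have c_cycle x : order rho x = d -> is_cycle rho (c x).
  by move=> ox; rewrite /is_cycle cE // cycle_orbit // orbit_uniq.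
pose g x := rotation_class (c x).
have imE : [set rotation_class s | s : d.-tuple T & is_cycle rho s] = g @: X.
  apply/setP => A; apply/imsetP/imsetP => [[s s_cyc ->]|[x xX ->]]; last first.
    by exists (c x) => //; move: xX; rewrite !inE => /eqP/c_cycle.
  move: s_cyc; rewrite inE => s_cyc; case/andP: (s_cyc) => s_f s_u.
  have s_sz := size_tuple s.
  case Es: (tval s) s_sz s_f s_u => [|x s'] s_sz s_f s_u.
    by rewrite -s_sz in d_gt0.
  have ox : order rho x = d by rewrite (order_cycle s_f s_u) ?mem_head.
  exists x; first by rewrite inE ox.
  congr rotation_class; apply: val_inj; rewrite /= Es cE //.
  by rewrite /orbit ox -s_sz -(fcycle_consE s_f).
rewrite /num_cycles imE -[RHS]sum1_card (partition_big_imset g) /=.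
rewrite -sum_nat_const.
apply: eq_bigr => A /imsetP[x]; rewrite inE => /eqP ox ->.
(* The fibre of g over the class of x is the orbit of x. *)
rewrite sum1_card -{1}ox; apply: eq_card => y.
rewrite -[RHS]/((y \in X) && (g y == g x)) [y \in X]inE eq_rotation_class //.
rewrite -[LHS]/(fconnect rho x y) fconnect_orbit.
symmetry; apply/andP/idP => [[/eqP oy /rotation_classP[//|i cy]]|].
  have: y \in orbit rho y by rewrite -fconnect_orbit connect0.
  by rewrite -(cE y oy) cy mem_rot cE.
move=> y_in; have oy : order rho y = d.
  rewrite (order_cycle (cycle_orbit _ x) (orbit_uniq _ _) y_in) //.
  by rewrite size_orbit.
split; first exact/eqP.
have [i oy_rot] :=
  orbit_rot_cycle (cycle_orbit rho_inj x) (orbit_uniq rho x) y_in.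
by apply/rotation_classP => //; exists i; rewrite !cE.
Qed.
End CycleCount.

(** * Moebius inversion *)

Lemma mem_primes_mulp p m q : prime p -> (0 < m)%N ->
  (q \in primes (p * m)) = (q \in p :: primes m).
Proof.
by move=> p_pr m_gt0; rewrite primesM ?(prime_gt0 p_pr) // primes_prime // !inE.
Qed.

Lemma squarefree_mulp p m : prime p -> ~~ (p %| m)%N -> (0 < m)%N ->
  squarefree (p * m) = squarefree m.
Proof.
move=> p_pr pNm m_gt0; have p_gt0 := prime_gt0 p_pr.
rewrite /squarefree muln_gt0 p_gt0 m_gt0 /=.
rewrite (eq_all_r (fun q => mem_primes_mulp q p_pr m_gt0)) /=.
rewrite expnS expn1 dvdn_pmul2l // pNm /=.
apply: eq_in_all => q; rewrite mem_primes => /and3P[q_pr _ q_dvd_m].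
have q_neq_p : q != p by apply: contraNneq pNm => <-.
rewrite Gauss_dvdr //.
by rewrite coprimeXl // prime_coprime // dvdn_prime2.
Qed.

Lemma moebius_mulp p m : prime p -> ~~ (p %| m)%N -> (0 < m)%N ->
  moebius (p * m) = (- moebius m)%R.
Proof.
move=> p_pr pNm m_gt0; rewrite /moebius squarefree_mulp //.
have -> : size (primes (p * m)) = (size (primes m)).+1.
  apply: (@perm_size _ _ (p :: primes m)); apply: uniq_perm.
  - exact: primes_uniq.
  - by rewrite /= primes_uniq mem_primes p_pr m_gt0 (negbTE pNm).
  - by move=> q; apply: mem_primes_mulp.
by case: ifP => _; rewrite ?oppr0 // exprS mulN1r.
Qed.

Lemma moebius_dvd_sqr p m : prime p -> (p ^ 2 %| m)%N -> moebius m = 0%R.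
Proof.
move=> p_pr p2m; rewrite /moebius /squarefree.
case: posnP => //= m_gt0; case: allP => // /(_ p).
rewrite mem_primes p_pr m_gt0 p2m (dvdn_trans _ p2m) ?dvdn_exp //.
by move=> /(_ isT).
Qed.

Local Open Scope ring_scope.

(** For [m > 1] fix a prime [p] dividing [m]. Divisors divisible by [p ^ 2]
    contribute nothing, and multiplication by [p] pairs each divisor prime to
    [p] with one exactly divisible by [p], with opposite values of [moebius]. *)
Lemma sum_moebius m : (0 < m)%N ->
  \sum_(d <- divisors m) moebius d = (m == 1)%N%:R.
Proof.
move=> m_gt0; case: (ltngtP m 1%N) => [|m_gt1|->]; last by rewrite big_seq1.
  by case: m m_gt0.
have {}m_gt0 := ltnW m_gt1.
have p_pr := pdiv_prime m_gt1; have p_dvd := pdiv_dvd m.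
move: (pdiv m) p_pr p_dvd => p p_pr p_dvd; have p_gt0 := prime_gt0 p_pr.
rewrite (bigID (fun d => p %| d)%N) /=.
rewrite (bigID (fun d => p ^ 2 %| d)%N) /=.
rewrite [X in X + _ + _]big1 => [|d /andP[_ p2d]]; last first.
  exact: moebius_dvd_sqr p2d.
rewrite add0r -big_filter -[X in _ + X]big_filter.
set s := [seq d <- _ | ~~ (p %| d)%N].
have s_ok d : d \in s -> ~~ (p %| d)%N /\ (0 < d)%N.
  by rewrite mem_filter -dvdn_divisors // => /andP[-> /(dvdn_gt0 m_gt0) ->].
rewrite (perm_big (map (muln p) s)) /=; last first.
  apply: uniq_perm; rewrite ?filter_uniq ?divisors_uniq //.
    rewrite map_inj_uniq ?filter_uniq ?divisors_uniq // => x y /eqP.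
    by rewrite eqn_pmul2l // => /eqP.
  move=> d; rewrite mem_filter -dvdn_divisors //.
  apply/idP/mapP => [/andP[/andP[/dvdnP[e ->]]]|[e + ->]].
    rewrite [(e * p)%N]mulnC expnS expn1 dvdn_pmul2l // => pNe pe_dvd.
    exists e => //; rewrite mem_filter pNe -dvdn_divisors //.
    exact: dvdn_trans (dvdn_mull _ _) pe_dvd.
  rewrite mem_filter -dvdn_divisors // => /andP[pNe e_dvd].
  rewrite dvdn_mulr // expnS expn1 dvdn_pmul2l // pNe /=.
  by rewrite Gauss_dvd ?p_dvd // prime_coprime.
rewrite big_map -big_split big_seq big1 // => d /s_ok[pNd d_gt0] /=.
by rewrite moebius_mulp // addNr.
Qed.

(** Makes the range of summation independent of [e], so that double sums over
    divisors can be exchanged. *)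
Lemma sum_divisors_dvd (V : nmodType) (d e : nat) (G : nat -> V) :
    (0 < d)%N -> (e %| d)%N ->
  \sum_(k <- divisors e) G k = \sum_(k <- divisors d | (k %| e)%N) G k.
Proof.
move=> d_gt0 e_dvd; have e_gt0 := dvdn_gt0 d_gt0 e_dvd.
rewrite -[RHS]big_filter; apply: perm_big; apply: uniq_perm.
- exact: divisors_uniq.
- by rewrite filter_uniq ?divisors_uniq.
- move=> k; rewrite mem_filter -!dvdn_divisors //.
  by case: (boolP (k %| e)%N) => // /dvdn_trans->.
Qed.

(** Substituting the sum for [F] and exchanging, the coefficient of [A k] is the
    sum of [moebius] over the divisors of [d / k], which vanishes unless
    [k = d]. The relation between [F] and [A] is asked only at divisors of [d]:
    the counts of fixed points below are known only for divisors of n + 1. *)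
Lemma moebius_inversion (R : pzRingType) (F A : nat -> R) d : (0 < d)%N ->
    (forall e, (e %| d)%N -> F e = \sum_(k <- divisors e) A k) ->
  \sum_(d' <- divisors d) (moebius d')%:~R * F (d %/ d')%N = A d.
Proof.
move=> d_gt0 FA.
have dvd_swap x y : (x %| d)%N -> (y %| d)%N ->
    (y %| d %/ x)%N = (x %| d %/ y)%N.
  move=> x_dvd y_dvd; have x_gt0 := dvdn_gt0 d_gt0 x_dvd.
  have y_gt0 := dvdn_gt0 d_gt0 y_dvd.
  by rewrite !dvdn_divRL // mulnC.
transitivity (\sum_(d' <- divisors d) \sum_(k <- divisors d)
    if (k %| d %/ d')%N then (moebius d')%:~R * A k else 0).
  apply: eq_big_seq => d'; rewrite -dvdn_divisors // => d'_dvd.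
  have e_dvd : (d %/ d' %| d)%N by rewrite dvdn_div.
  by rewrite FA // (sum_divisors_dvd _ d_gt0) // mulr_sumr -big_mkcond.
rewrite exchange_big /=.
transitivity (\sum_(k <- divisors d) if k == d then A k else 0).
  apply: eq_big_seq => k; rewrite -dvdn_divisors // => k_dvd.
  have e_dvd : (d %/ k %| d)%N by rewrite dvdn_div.
  have k_gt0 := dvdn_gt0 d_gt0 k_dvd.
  rewrite -big_mkcond -mulr_suml -raddf_sum /=.
  have -> : \sum_(i <- divisors d | (k %| d %/ i)%N) moebius i
          = \sum_(i <- divisors (d %/ k)) moebius i.
    rewrite (sum_divisors_dvd _ d_gt0) // big_seq_cond [RHS]big_seq_cond.
    apply: eq_bigl => i.
    by rewrite -dvdn_divisors //; case: (boolP (i %| d)%N) => // /dvd_swap->.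
  have -> : (k == d) = (d %/ k == 1)%N by rewrite [RHS]eq_sym eqn_div // mul1n.
  rewrite sum_moebius ?divn_gt0 //; last exact: dvdn_leq.
  by case: eqP; rewrite ?mul1r ?mul0r.
have d_in : d \in divisors d by rewrite divisors_id.
rewrite (bigD1_seq d d_in (divisors_uniq d)) /= eqxx.
by rewrite big1 ?addr0 // => k /negbTE->.
Qed.

(** * Periodic sequences *)

Lemma periodic_mulnD (V : Type) (v : nat -> V) p k q :
  (forall i, v (i + p)%N = v i) -> v (k + q * p)%N = v k.
Proof.
move=> v_per; elim: q => [|q IHq]; first by rewrite addn0.
by rewrite mulSn addnCA addnC v_per.
Qed.

Lemma periodic_modn (V : Type) (v : nat -> V) p k :
  (forall i, v (i + p)%N = v i) -> v (k %% p)%N = v k.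
Proof. by move=> v_per; rewrite [in RHS](divn_eq k p) addnC periodic_mulnD. Qed.

Lemma sum_periodic (V : nmodType) (v : nat -> V) p q :
    (forall i, v (i + p)%N = v i) ->
  \sum_(0 <= k < q * p) v k = (\sum_(0 <= k < p) v k) *+ q.
Proof.
move=> v_per; rewrite big_nat_mul -{2}[q]subn0 -sumr_const_nat.
apply: eq_bigr => i _; rewrite mulSn -{1}[(i * p)%N]add0n big_addn addnK.
by under eq_bigr do rewrite periodic_mulnD //.
Qed.

(** * The output sequence of the pure summing register *)

Lemma pchar2_F2 : 2%N \in [pchar 'F_2].
Proof. exact: pchar_Fp. Qed.

Section PSR.
Variable n : nat.
Implicit Type x : n.-tuple 'F_2.
Notation psr := (next_state (@psr_feedback n)).

(** The bits put out by the register started in [x]: the state followed by its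
    feedback bit, repeated for ever. That the register really produces this
    sequence is [psr_output_next]. *)
Definition psr_output x k : 'F_2 :=
  nth 0 (rcons x (psr_feedback x)) (k %% n.+1).

Lemma psr_output_small x k : (k < n)%N -> psr_output x k = nth 0 x k.
Proof.
move=> k_lt; rewrite /psr_output modn_small ?nth_rcons ?size_tuple ?k_lt //.
exact: ltnW.
Qed.

Lemma psr_output_last x : psr_output x n = psr_feedback x.
Proof. by rewrite /psr_output modn_small // nth_rcons size_tuple ltnn eqxx. Qed.

Lemma psr_output_period x k : psr_output x (k + n.+1) = psr_output x k.
Proof. by rewrite /psr_output modnDr. Qed.

Lemma psr_output_inj x y : psr_output x =1 psr_output y -> x = y.
Proof.
move=> eq_xy; apply: eq_from_tnth => i; rewrite !(tnth_nth 0).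
by rewrite -!psr_output_small.
Qed.

Lemma sum_psr_output x : \sum_(0 <= k < n.+1) psr_output x k = 0.
Proof.
rewrite big_nat_recr //= psr_output_last big_mkord.
under eq_bigr => i _ do rewrite psr_output_small // -tnth_nth.
exact: addrr_pchar2 pchar2_F2 _.
Qed.

(** The first [n] values of a zero-sum periodic sequence are free, and the value
    at [n] is then forced to be their sum, the feedback bit. *)
Lemma psr_output_onto (v : nat -> 'F_2) :
    (forall k, v (k + n.+1)%N = v k) -> \sum_(0 <= k < n.+1) v k = 0 ->
  psr_output [tuple v i | i < n] =1 v.
Proof.
move=> v_per v_sum k.
rewrite -(periodic_modn k v_per) -(periodic_modn k (psr_output_period _)).
have := ltn_pmod k (ltn0Sn n); rewrite ltnS leq_eqVlt => /predU1P[->|k_lt].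
  rewrite psr_output_last; apply/eqP; rewrite -subr_eq0 (oppr_pchar2 pchar2_F2).
  apply/eqP; rewrite -[RHS]v_sum big_nat_recr //= big_mkord; congr (_ + _).
  by apply: eq_bigr => i _; rewrite tnth_mktuple.
rewrite psr_output_small // -[(k %% _)%N]/(nat_of_ord (Ordinal k_lt)).
by rewrite -tnth_nth tnth_mktuple.
Qed.

(** The shifted sequence is again periodic with zero sum over a period, so it is
    the output of some state, and its first [n] bits are those of the next
    state. *)
Lemma psr_output_next x k : psr_output (psr x) k = psr_output x k.+1.
Proof.
suff -> : psr x = [tuple psr_output x i.+1 | i < n].
  apply: (psr_output_onto (v := fun k => psr_output x k.+1)) => [{}k|].
    by rewrite -addSn psr_output_period.
  rewrite big_nat_recr //= -[X in psr_output x X]add0n psr_output_period addrC.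
  by rewrite -[RHS](sum_psr_output x) [RHS]big_nat_recl.
apply: eq_from_tnth => i; rewrite !tnth_mktuple.
have := ltn_ord i; rewrite leq_eqVlt => /predU1P[in_eq|i_lt].
  by rewrite in_eq psr_output_last nth_default // size_tuple.
by rewrite psr_output_small //; apply: set_nth_default; rewrite size_tuple.
Qed.

Lemma psr_output_iter x e k :
  psr_output (iter e psr x) k = psr_output x (k + e).
Proof.
by elim: e k => [|e IHe] k; rewrite ?addn0 //= psr_output_next IHe addSnnS.
Qed.

Lemma psr_iter_id x : iter n.+1 psr x = x.
Proof.
by apply: psr_output_inj => k; rewrite psr_output_iter psr_output_period.
Qed.

Lemma psr_inj : injective psr.
Proof.
by move=> x y eq_xy; rewrite -(psr_iter_id x) -(psr_iter_id y) !iterSr eq_xy.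
Qed.

(** A state is fixed by the [e]-th iterate exactly when its output has period
    [e], that is, repeats its first [e] bits [w]. One period of length n + 1
    then consists of (n + 1) / e copies of [w], whence the condition on the sum. *)
Lemma card_psr_iter_fixed e : (e %| n.+1)%N ->
  #|[set x | iter e psr x == x]| =
  #|[set w : e.-tuple 'F_2 | (\sum_(i < e) tnth w i) *+ (n.+1 %/ e) == 0]|.
Proof.
move=> e_dvd; have e_gt0 := dvdn_gt0 (ltn0Sn n) e_dvd.
(* v w repeats the block w, and phi w is the state with output v w. *)
pose v (w : e.-tuple 'F_2) k : 'F_2 := nth 0 w (k %% e).
have v_period w k : v w (k + e)%N = v w k by rewrite /v modnDr.
have v_periodN w k : v w (k + n.+1)%N = v w k.
  by rewrite -(divnK e_dvd) periodic_mulnD.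
have v_small w k : (k < e)%N -> v w k = nth 0 w k.
  by move=> ?; rewrite /v modn_small.
have v_sum w :
    \sum_(0 <= k < n.+1) v w k = (\sum_(i < e) tnth w i) *+ (n.+1 %/ e).
  rewrite -{1}(divnK e_dvd) sum_periodic // big_mkord.
  by under eq_bigr => i _ do rewrite v_small // -tnth_nth.
pose phi w : n.-tuple 'F_2 := [tuple v w i | i < n].
pose W :=
  [set w : e.-tuple 'F_2 | (\sum_(i < e) tnth w i) *+ (n.+1 %/ e) == 0].
rewrite -/W.
have phi_out w : w \in W -> psr_output (phi w) =1 v w.
  by rewrite inE -v_sum => /eqP w0; apply: psr_output_onto.
rewrite -(@card_in_imset _ _ phi W) => [|w1 w2 w1W w2W eq_phi]; last first.
  apply: eq_from_tnth => i; rewrite !(tnth_nth 0) -!v_small //.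
  by rewrite -!phi_out // eq_phi.
apply: eq_card => x; rewrite inE.
apply/eqP/imsetP => [x_fix|[w wW ->]]; last first.
  by apply: psr_output_inj => k; rewrite psr_output_iter !phi_out.
pose w := [tuple psr_output x i | i < e].
have x_per k : psr_output x (k + e) = psr_output x k.
  by rewrite -psr_output_iter x_fix.
have wE : v w =1 psr_output x.
  move=> k; have k_lt := ltn_pmod k e_gt0.
  rewrite -(periodic_modn k x_per) /v -[(k %% e)%N]/(nat_of_ord (Ordinal k_lt)).
  by rewrite -tnth_nth tnth_mktuple.
have wW : w \in W.
  by rewrite inE -v_sum; under eq_bigr do rewrite wE; rewrite sum_psr_output.
by exists w => //; apply: psr_output_inj => k; rewrite phi_out.
Qed.
End PSR.

Lemma card_F2_tuple e : #|{: e.-tuple 'F_2}| = (2 ^ e)%N.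
Proof. by rewrite card_tuple card_Fp. Qed.

(** The previous correspondence for PSR_e and its (e + 1)-st iterate, which is
    the identity: all 2 ^ e states are fixed, and the blocks are the zero-sum
    words of length e + 1. *)
Lemma card_zero_sum e :
  #|[set w : e.+1.-tuple 'F_2 | \sum_(i < e.+1) tnth w i == 0]| = (2 ^ e)%N.
Proof.
have := @card_psr_iter_fixed e e.+1 (dvdnn _).
(* Locking keeps /= from unfolding one step of the iteration. *)
rewrite divnn [iter]lock /= -lock => <-.
rewrite -card_F2_tuple -cardsT; apply: eq_card => x.
by rewrite !inE (psr_iter_id x) eqxx.
Qed.

(** * Counting the cycles of the pure summing register *)

Lemma card_psr_iter_fixedE n e : (e %| n.+1)%N ->
  #|[set x | iter e (next_state (@psr_feedback n)) x == x]| =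
    (if odd (n.+1 %/ e) then 2 ^ e.-1 else 2 ^ e)%N.
Proof.
move=> e_dvd; rewrite card_psr_iter_fixed //.
have mulF2 (a : 'F_2) m : a *+ m = a *+ odd m.
  rewrite {1}(divn_eq m 2) mulrnDr mulrnA -modn2 mulr2n.
  by rewrite addrr_pchar2 ?pchar2_F2 // add0r.
have e_gt0 := dvdn_gt0 (ltn0Sn n) e_dvd.
case: ifP => m_odd.
  case: e e_gt0 e_dvd m_odd => // e _ _ m_odd; rewrite -card_zero_sum.
  by apply: eq_card => w; rewrite !inE mulF2 m_odd.
rewrite -card_F2_tuple -cardsT; apply: eq_card => w.
by rewrite !inE mulF2 m_odd eqxx.
Qed.

(** Moebius inversion of the fixed point counts. The quotient of n + 1 by
    [d / d'] is [(n.+1 %/ d) * d'], so its parity, which decides whether a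
    factor 2 is lost, is the conjunction of the parities of its factors. *)
Lemma psr_num_cycles_moebius n d : (d %| n.+1)%N ->
  (psr_num_cycles n d)%:R * d%:R =
    \sum_(d' <- divisors d) (moebius d')%:~R *
      (if odd (n.+1 %/ d) && odd d' then 2 ^+ (d %/ d')%N / 2
       else 2 ^+ (d %/ d')%N) :> rat.
Proof.
move=> d_dvd; have d_gt0 := dvdn_gt0 (ltn0Sn n) d_dvd.
pose rho := next_state (@psr_feedback n).
pose F e : rat := #|[set x | iter e rho x == x]|%:R.
pose A k : rat := #|[set x | order rho x == k]|%:R.
rewrite -natrM (num_cyclesE (@psr_inj n) d_gt0) -/(A d).
rewrite -(moebius_inversion (F := F) d_gt0) => [|e e_dvd]; last first.
  rewrite /F (card_iter_fixed (@psr_inj n)) ?natr_sum //.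
  exact: dvdn_gt0 d_gt0 e_dvd.
apply: eq_big_seq => d'; rewrite -dvdn_divisors // => d'_dvd.
have d'_gt0 := dvdn_gt0 d_gt0 d'_dvd.
have e_dvd : (d %/ d' %| n.+1)%N by apply: dvdn_trans d_dvd; apply: dvdn_div.
have e_gt0 := dvdn_gt0 (ltn0Sn n) e_dvd.
rewrite /F card_psr_iter_fixedE //.
have -> : (n.+1 %/ (d %/ d') = n.+1 %/ d * d')%N.
  apply/eqP; rewrite -(eqn_pmul2r e_gt0) divnK // -mulnA [(d' * _)%N]mulnC.
  by rewrite !divnK.
rewrite oddM; case: ifP => _; rewrite natrX //.
by rewrite -[in RHS](prednK e_gt0) exprSr mulfK.
Qed.

Theorem lemma1 (n d : nat) (hn : (1 <= n)%N) (hd : (0 < d)%N) :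
  ((~~ odd n /\ (d %| n.+1)%N) \/
   [/\ odd n, (d %| n.+1)%N & odd (n.+1 %/ d)%N] ->
   (psr_num_cycles n d)%:R =
     1 / (2 * d%:R) *
       (\sum_(d' <- divisors d) (moebius d')%:~R * 2 ^+ (d %/ d')%N) +
     1 / (2 * d%:R) *
       (\sum_(d' <- divisors d | ~~ odd d')
          (moebius d')%:~R * 2 ^+ (d %/ d')%N) :> rat)
  /\
  (odd n -> (d %| n.+1)%N -> ~~ odd (n.+1 %/ d)%N ->
   (psr_num_cycles n d)%:R =
     1 / d%:R *
       (\sum_(d' <- divisors d) (moebius d')%:~R * 2 ^+ (d %/ d')%N) :> rat).
Proof.
have d_neq0 : d%:R != 0 :> rat by rewrite pnatr_eq0 -lt0n.
split=> [par|_ d_dvd quo_even]; last first.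
  apply: (mulIf d_neq0); rewrite psr_num_cycles_moebius // (negbTE quo_even) /=.
  by rewrite mul1r mulrAC mulVf ?mul1r.
have [d_dvd quo_odd] : (d %| n.+1)%N /\ odd (n.+1 %/ d).
  case: par => [[n_even d_dvd]|[_ ? ?]]; split=> //.
  by move: n_even; rewrite -oddS -{1}(divnK d_dvd) oddM => /andP[].
apply: (mulIf d_neq0); rewrite psr_num_cycles_moebius // quo_odd /=.
(* Termwise: half of each term, plus half of it again when d' is even. *)
rewrite -mulrDr invfM !mul1r mulrAC divfK // [X in _ + X]big_mkcond.
rewrite -big_split mulr_sumr; apply: eq_bigr => d' _ /=.
case: (odd d') => /=; first by rewrite addr0 [RHS]mulrC mulrA.
by apply: (@mulfI _ 2) => //; rewrite mulVKf // mulr_natl mulr2n.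
Qed.
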